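(* Let $\alpha_0+2\alpha_1+3\alpha_2=1$ and consider the system $$\frac{dx}{dt}=4x^3y+2(\alpha_0+2\alpha_1)x^2+2tx+1,$$ $$\frac{dy}{dt}=-6x^2y^2-4(\alpha_0+2\alpha_1)xy-2ty-2\alpha_1(\alpha_0+\alpha_1).$$ Make the change of parameters and variables $$\beta_0=\alpha_1+3\alpha_2,\quad\beta_1=\alpha_0,\quad\beta_2=\alpha_1,\qquad X=\frac1x,\quad Y=-x(xy+\alpha_1),\quad T=t.$$ Then the system can be written in the new variables $T,X,Y$ and parameters $\beta_0,\beta_1,\beta_2$ as a Hamiltonian system, and this new system is the system of type $A_2^{(1)}$: $$\frac{dX}{dT}=-X^2+4XY-2TX-2\beta_1,\qquad \frac{dY}{dT}=-2Y^2+2XY+2TY+\beta_2,$$ with the Hamiltonian $$H_{A_2^{(1)}}(X,Y,T;\beta_0,\beta_1,\beta_2)=-2TXY-X^2Y+2XY^2-2\beta_1Y-\beta_2X.$$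
   Context: A Hamiltonian system with Hamiltonian $K(X,Y,T)$ means $dX/dT=\partial K/\partial Y$, $dY/dT=-\partial K/\partial X$. *)

(* Defs.v *)
From HB Require Import structures.
From mathcomp Require Import all_boot all_order all_algebra.
From mathcomp Require Import all_classical all_reals all_analysis.

Set Implicit Arguments.
Unset Strict Implicit.
Unset Printing Implicit Defensive.

Import Order.TTheory GRing.Theory Num.Theory.
Import numFieldNormedType.Exports.

Local Open Scope classical_set_scope.
Local Open Scope ring_scope.

(* Every [K : numFieldType] is a normed module over itself, and [is_derive] is
   differentiation with respect to the norm of [K]: ordinary differentiation
   for the real field, holomorphic differentiation for the complex field. *)

Definition vfield (K : numFieldType) := K -> K -> K -> K.

(* [(q, p)] solves [dq/dt = f(q,p,t)], [dp/dt = g(q,p,t)] on [U]. *)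
Definition is_solution (K : numFieldType) (f g : vfield K) (U : set K)
    (q p : K -> K) : Prop :=
  forall t, U t ->
    is_derive t (1 : K) q (f (q t) (p t) t) /\
    is_derive t (1 : K) p (g (q t) (p t) t).

(* [f = dH/dY] and [g = - dH/dX]. *)
Definition is_hamiltonian (K : numFieldType) (f g H : vfield K) : Prop :=
  forall X Y T : K,
    is_derive Y (1 : K) (fun Y' => H X Y' T) (f X Y T) /\
    is_derive X (1 : K) (fun X' => H X' Y T) (- g X Y T).

Definition dx_old (K : numFieldType) (a0 a1 : K) : vfield K := fun x y t =>
  4 * x ^+ 3 * y + 2 * (a0 + 2 * a1) * x ^+ 2 + 2 * t * x + 1.

Definition dy_old (K : numFieldType) (a0 a1 : K) : vfield K := fun x y t =>
  - 6 * x ^+ 2 * y ^+ 2 - 4 * (a0 + 2 * a1) * x * y - 2 * t * y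
  - 2 * a1 * (a0 + a1).

Definition newX (K : numFieldType) (x : K) : K := 1 / x.

Definition newY (K : numFieldType) (a1 x y : K) : K := - x * (x * y + a1).

Definition newT (K : numFieldType) (t : K) : K := t.

Definition dX_A2 (K : numFieldType) (b1 : K) : vfield K := fun X Y T =>
  - X ^+ 2 + 4 * X * Y - 2 * T * X - 2 * b1.

Definition dY_A2 (K : numFieldType) (b2 : K) : vfield K := fun X Y T =>
  - 2 * Y ^+ 2 + 2 * X * Y + 2 * T * Y + b2.

(* [b0] does not occur in the formula; it is determined by [b0 + b1 + b2 = 1],
   the normalization of the parameters of type A_2^(1). *)
Definition H_A2 (K : numFieldType) (X Y T b0 b1 b2 : K) : K :=
  - 2 * T * X * Y - X ^+ 2 * Y + 2 * X * Y ^+ 2 - 2 * b1 * Y - b2 * X.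

(* Main.v *)
Require Import Defs.
From HB Require Import structures.
From mathcomp Require Import all_boot all_order all_algebra.
From mathcomp Require Import all_classical all_reals all_analysis.
From mathcomp Require Import ring.

(** The map [(x, y) |-> (1 / x, - x (x y + a1))] is an involution on
    [x != 0], so both implications follow from one chain-rule computation
    along the map, applied once to [(x, y)] and once to [(X, Y)]. *)

Import Order.TTheory GRing.Theory Num.Theory.
Import numFieldNormedType.Exports.

Local Open Scope classical_set_scope.
Local Open Scope ring_scope.

(** [H_A2] has degree two in [X] and in [Y] separately, so this formula serves for both of its
    partial derivatives. *)
Lemma is_derive_quadratic (K : numFieldType) (a b c z : K) :
  is_derive z (1 : K) (fun s : K => a * s ^+ 2 + b * s + c) (2 * a * z + b).
Proof.
(* In this point-free form, instance inference assembles the derivative from the [is_derive]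
   rules. *)
have -> : (fun s : K => a * s ^+ 2 + b * s + c) =
          (a \*: (id : K -> K) ^+ 2 + b \*: (id : K -> K) + cst c : K -> K).
  by apply/funext => s.
apply: is_derive_eq.
by rewrite /GRing.scale /=; ring.
Qed.

(* [is_deriveV] of the library covers only functions on a [realType]. *)
Lemma is_derive_inv (K : numFieldType) (f : K -> K) (t df : K) :
  f t != 0 -> is_derive t (1 : K) f df ->
  is_derive t (1 : K) (fun s => (f s)^-1) (- df / f t ^+ 2).
Proof.
move=> ft0 [fd <-]; apply: DeriveDef; first exact: derivableV.
by rewrite deriveV // /GRing.scale /= !mulNr mulrC.
Qed.

Lemma is_derive_newX (K : numFieldType) (x : K -> K) (t dx : K) :
  x t != 0 -> is_derive t (1 : K) x dx ->
  is_derive t (1 : K) (fun s => newX (x s)) (- dx / x t ^+ 2).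
Proof.
move=> xt0 xd; have -> : (fun s => newX (x s)) = (fun s => (x s)^-1).
  by apply/funext => s; rewrite /newX div1r.
exact: is_derive_inv.
Qed.

Lemma is_derive_newY (K : numFieldType) (a1 : K) (x y : K -> K) (t dx dy : K) :
  is_derive t (1 : K) x dx -> is_derive t (1 : K) y dy ->
  is_derive t (1 : K) (fun s => newY a1 (x s) (y s))
    (- (2 * x t * y t * dx + x t ^+ 2 * dy + a1 * dx)).
Proof.
move=> xd yd; have -> : (fun s => newY a1 (x s) (y s)) =
    (- x * (x * y + cst a1) : K -> K).
  by apply/funext => s.
apply: is_derive_eq.
(* Evaluating the operations on functions at [t] leaves an identity in [K] for [ring]. *)
rewrite -[(- x) t]/(- x t) -[(x * y + cst a1) t]/(x t * y t + a1).
by rewrite /GRing.scale /=; ring.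
Qed.

(** The product of the new variables is [- (x * y + a1)]; adding [a1] leaves [- x * y], and the
    factor [- 1 / x] turns this into [y]. *)
Lemma newXY_involutive (K : numFieldType) (a1 x y : K) : x != 0 ->
  newX (newX x) = x /\ newY a1 (newX x) (newY a1 x y) = y.
Proof. by move=> x0; rewrite /newX /newY; split; field. Qed.

(** The new functions are tied to the old ones only on [U]; openness makes the relation hold near
    [t], which is enough to transfer derivatives. With [dX] and [dY] arbitrary, the lemma fits
    either direction and leaves only algebraic identities. *)
Lemma is_derive_newXY_near (K : numFieldType) (a1 : K) (U : set K)
    (x y X Y : K -> K) (t dx dy dX dY : K) :
  open U -> U t ->
  (forall s, U s -> X s = newX (x s) /\ Y s = newY a1 (x s) (y s)) ->
  x t != 0 -> is_derive t (1 : K) x dx -> is_derive t (1 : K) y dy ->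
  - dx / x t ^+ 2 = dX ->
  - (2 * x t * y t * dx + x t ^+ 2 * dy + a1 * dx) = dY ->
  is_derive t (1 : K) X dX /\ is_derive t (1 : K) Y dY.
Proof.
move=> Uo Ut XY xt0 xd yd <- <-.
have nU : \forall s \near t, U s by exact: open_nbhs_nbhs.
split.
- apply: near_eq_is_derive (is_derive_newX _ _ _ _ xt0 xd).
  by apply: filterS nU => s /XY[].
- apply: near_eq_is_derive (is_derive_newY _ a1 _ _ _ _ _ xd yd).
  by apply: filterS nU => s /XY[].
Qed.

Lemma A2_is_hamiltonian (K : numFieldType) (b0 b1 b2 : K) :
  is_hamiltonian (dX_A2 b1) (dY_A2 b2) (fun X Y T => H_A2 X Y T b0 b1 b2).
Proof.
move=> X Y T; split.
- have -> : (fun Y' => H_A2 X Y' T b0 b1 b2) =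
      (fun s => 2 * X * s ^+ 2 + (- 2 * T * X - X ^+ 2 - 2 * b1) * s
                + - b2 * X).
    by apply/funext => s; rewrite /H_A2; ring.
  apply: is_derive_eq (is_derive_quadratic _ _ _ _ _) _.
  by rewrite /dX_A2; ring.
- have -> : (fun X' => H_A2 X' Y T b0 b1 b2) =
      (fun s => - Y * s ^+ 2 + (- 2 * T * Y + 2 * Y ^+ 2 - b2) * s
                + - 2 * b1 * Y).
    by apply/funext => s; rewrite /H_A2; ring.
  apply: is_derive_eq (is_derive_quadratic _ _ _ _ _) _.
  by rewrite /dY_A2; ring.
Qed.

Theorem theorem2p5 (K : numFieldType) (a0 a1 a2 b0 b1 b2 : K)
  (ha : a0 + 2 * a1 + 3 * a2 = 1)
  (hb0 : b0 = a1 + 3 * a2) (hb1 : b1 = a0) (hb2 : b2 = a1) :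
  b0 + b1 + b2 = 1 /\
  is_hamiltonian (dX_A2 b1) (dY_A2 b2)
    (fun X Y T => H_A2 X Y T b0 b1 b2) /\
  forall (U : set K) (x y X Y : K -> K),
    open U ->
    (forall t, U t -> x t != 0) ->
    (forall t, U t -> X (newT t) = newX (x t) /\
                      Y (newT t) = newY a1 (x t) (y t)) ->
    (is_solution (dx_old a0 a1) (dy_old a0 a1) U x y <->
     is_solution (dX_A2 b1) (dY_A2 b2) (@newT K @` U) X Y).
Proof.
split; first by rewrite hb0 hb1 hb2 -[RHS]ha; ring.
split; first exact: A2_is_hamiltonian.
move=> U x y X Y Uo x0; rewrite /newT image_id hb1 hb2 => XY.
(* By involutivity the relation on [U] is symmetric in the two pairs. *)
have xy s : U s -> x s = newX (X s) /\ y s = newY a1 (X s) (Y s).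
  move=> Us; have [-> ->] := XY s Us.
  by have [-> ->] := newXY_involutive K a1 (x s) (y s) (x0 s Us).
split=> sol t Ut; have [d1 d2] := sol t Ut; have xt0 := x0 t Ut;
    have [Xt Yt] := XY t Ut.
- apply: (is_derive_newXY_near _ _ _ _ _ _ _ _ _ _ _ _ Uo Ut XY xt0 d1 d2).
  (* Both vector fields are now rational in [x t], [y t] and [t], with powers of [x t] as the only
     denominators. *)
  + by rewrite Xt Yt /dX_A2 /dx_old /newX /newY; field.
  + by rewrite Xt Yt /dY_A2 /dx_old /dy_old /newX /newY; field.
- have Xt0 : X t != 0 by rewrite Xt /newX div1r invr_eq0.
  have [xt yt] := xy t Ut.
  (* The same lemma with the two pairs exchanged; the remaining identities are in [X t] and
     [Y t]. *)
  apply: (is_derive_newXY_near _ _ _ _ _ _ _ _ _ _ _ _ Uo Ut xy Xt0 d1 d2).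
  + by rewrite xt yt /dX_A2 /dx_old /newX /newY; field.
  + by rewrite xt yt /dX_A2 /dY_A2 /dy_old /newX /newY; field.
Qed.
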